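(* For every positive integer $n$, there exists a finite group $G$ such that the graph $\Lambda^+(G)$ has more than $n$ connected components.
   Context: Let $G$ be a finite group. For conjugacy classes $C, D$ of $G$, we say that $C$ and $D$ invariably generate $G$, and write $\langle C, D\rangle_I = G$, if $\langle x, y\rangle = G$ for every $x \in C$ and every $y \in D$. The invariably generating graph $\Lambda(G)$ is the undirected graph whose vertices are the conjugacy classes of $G$ different from $\{1\}$, where two vertices $C$ and $D$ are adjacent if $\langle C, D\rangle_I = G$. The graph $\Lambda^+(G)$ is obtained from $\Lambda(G)$ by removing its isolated vertices. *)

(* Defs.v *)
From HB Require Import structures.
From mathcomp Require Import all_boot all_order all_fingroup.

Set Implicit Arguments.
Unset Strict Implicit.
Unset Printing Implicit Defensive.

Local Open Scope group_scope.

Section InvariablyGeneratingGraph.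

Variables (gT : finGroupType) (G : {group gT}).

Definition inv_generate (C D : {set gT}) : bool :=
  [forall x in C, forall y in D, <<[set x; y]>> == G].

Definition Lambda_vertices : {set {set gT}} := classes G :\ [1 gT].

(* The graph lives on the finite type {set gT}, so being a vertex is part of
   the edge relation. Loops are excluded; a class could only carry a loop when
   G is cyclic. *)
Definition Lambda_adj : rel {set gT} := fun C D =>
  [&& C \in Lambda_vertices, D \in Lambda_vertices, C != D & inv_generate C D].

Definition Lambda_plus_vertices : {set {set gT}} :=
  [set C in Lambda_vertices | [exists D, Lambda_adj C D]].

Lemma Lambda_adj_sym : symmetric Lambda_adj.
Proof.
suff H C D : Lambda_adj C D -> Lambda_adj D C by move=> C D; apply/idP/idP => /H.
case/and4P=> VC VD neqCD /forall_inP genCD.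
apply/and4P; split=> //; first by rewrite eq_sym.
apply/forall_inP=> y Dy; apply/forall_inP=> x Cx.
by rewrite setUC; have /forall_inP := genCD x Cx; apply.
Qed.

Lemma Lambda_plus_closed : fingraph.closed Lambda_adj (mem Lambda_plus_vertices).
Proof.
move=> C D adjCD; have /and4P[VC VD _ _] := adjCD.
rewrite !inE in VC VD *; rewrite VC VD /=.
apply/existsP/existsP => _; last by exists D.
by exists C; rewrite Lambda_adj_sym.
Qed.

(* n_comp counts connected components as intended because the edge relation is
   symmetric and the non-isolated vertices are closed under adjacency. *)
Definition Lambda_plus_components : nat :=
  n_comp Lambda_adj (mem Lambda_plus_vertices).

End InvariablyGeneratingGraph.

(* Main.v *)
(** Let F be a noncyclic group of order p q, with p and q distinct primes. Two
elements of the same prime order generate conjugate Sylow subgroups, so they do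
not invariably generate F: the graph of F is bipartite, elements of order p
facing elements of order q. Take a product of such groups F_1, ..., F_k of
pairwise coprime orders. A pair invariably generates the product iff all its
components do, so moving along an edge changes the side in every factor at
once. The sides in the factors 2, ..., k relative to the side in the first one
are therefore constant on components, and all 2^(k-1) patterns occur: swapping
the two entries of an invariably generating pair of one factor gives another. *)

Require Import Defs.
From mathcomp Require Import all_boot all_order all_fingroup.
From mathcomp Require Import zmodp all_solvable.

Set Implicit Arguments.
Unset Strict Implicit.
Unset Printing Implicit Defensive.
Local Open Scope group_scope.

(** * Invariably generating pairs of elements, and direct products *)

Definition inv_gen_pair (gT : finGroupType) (x y : gT) : bool :=
  inv_generate [set: gT] (x ^: [set: gT]) (y ^: [set: gT]).

Lemma inv_gen_pairP (gT : finGroupType) (x y : gT) :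
  reflect (forall g h, <<[set x ^ g; y ^ h]>> = [set: gT]) (inv_gen_pair x y).
Proof.
apply: (iffP forall_inP) => [gen g h | gen _ /imsetP[g _ ->]].
  have /forall_inP/(_ _ (memJ_class y (in_setT h)))/eqP :=
    gen _ (memJ_class x (in_setT g)).
  by [].
by apply/forall_inP=> _ /imsetP[h _ ->]; rewrite gen.
Qed.

Lemma inv_gen_pairC (gT : finGroupType) (x y : gT) :
  inv_gen_pair x y = inv_gen_pair y x.
Proof. by apply/inv_gen_pairP/inv_gen_pairP=> gen g h; rewrite setUC. Qed.

Lemma morphim_gen2 (aT rT : finGroupType) (D : {group aT})
    (f : {morphism D >-> rT}) (x y : aT) :
  x \in D -> y \in D -> f @* <<[set x; y]>> = <<[set f x; f y]>>.
Proof.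
move=> Dx Dy; rewrite morphim_gen ?morphimU ?morphim_set1 //.
by rewrite subUset !sub1set Dx.
Qed.

Lemma inv_gen_pair_morphim (aT rT : finGroupType)
    (f : {morphism [set: aT] >-> rT}) (x y : aT) :
  f @* [set: aT] = [set: rT] -> inv_gen_pair x y -> inv_gen_pair (f x) (f y).
Proof.
move=> surj_f /inv_gen_pairP gen; apply/inv_gen_pairP=> g h.
have := in_setT g; have := in_setT h; rewrite -surj_f.
move=> /morphimP[h' _ _ ->] /morphimP[g' _ _ ->].
by rewrite -!morphJ ?inE // -morphim_gen2 ?inE // gen.
Qed.

(** The subgroup generated by conjugates of [u] and [v] projects onto both factors, so both orders
    divide its order; as they are coprime, so does their product. The converse is stability under
    surjective morphisms. *)
Lemma inv_gen_pair_prod (gT1 gT2 : finGroupType) (u v : gT1 * gT2) :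
    coprime #|[set: gT1]| #|[set: gT2]| ->
  inv_gen_pair u v = inv_gen_pair u.1 v.1 && inv_gen_pair u.2 v.2.
Proof.
move=> co12; pose p1 := [morphism of @fst gT1 gT2].
pose p2 := [morphism of @snd gT1 gT2].
apply/idP/andP => [gen | [/inv_gen_pairP gen1 /inv_gen_pairP gen2]].
  split; [apply: (inv_gen_pair_morphim (f := p1)) gen |
          apply: (inv_gen_pair_morphim (f := p2)) gen];
  apply/setP=> x; rewrite !inE; apply/imsetP.
    by exists (x, 1); rewrite ?inE.
  by exists (1, x); rewrite ?inE.
apply/inv_gen_pairP=> g h; apply/eqP.
rewrite eqEcard subsetT dvdn_leq ?cardG_gt0 //.
rewrite cardsT card_prod -!cardsT Gauss_dvd //.
rewrite -{1}(gen1 g.1 h.1) -{1}(gen2 g.2 h.2).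
rewrite -(morphim_gen2 p1 (x := u ^ g) (y := v ^ h)) ?inE //.
rewrite -(morphim_gen2 p2 (x := u ^ g) (y := v ^ h)) ?inE //.
by rewrite !dvdn_morphim.
Qed.

(** * Noncyclic groups of order [p * q] *)

(** Noncyclicity leaves only the orders [p] and [q] for [x] and [y]. If both had the same order,
    Sylow's theorem would place a conjugate of [x] inside the proper subgroup [<[y]>]. *)
Lemma inv_gen_pair_primes (gT : finGroupType) (p q : nat) (x y : gT) :
    prime p -> prime q -> p != q -> #|[set: gT]| = (p * q)%N ->
    ~~ cyclic [set: gT] ->
  inv_gen_pair x y -> (#[x] == p) != (#[y] == p).
Proof.
move=> p_pr q_pr npq oG ncG gxy.
have not_cycle (z : gT) : <[z]> != [set: gT].
  by apply: contra ncG => /eqP <-; apply: cycle_cyclic.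
have ord_pq (z t : gT) : inv_gen_pair z t -> (#[z] == p) || (#[z] == q).
  move=> /inv_gen_pairP gen.
  have ntz : #[z] != 1%N.
    rewrite order_eq1; apply: contra (not_cycle t) => /eqP z1.
    rewrite eqEsubset subsetT -(gen 1 1) z1 conj1g conjg1.
    by rewrite gen_subG subUset !sub1set group1 cycle_id.
  have : #[z] %| p * q by rewrite -oG order_dvdG ?inE.
  have [/dvdnP[k oz] | npz] := boolP (p %| #[z]).
    rewrite {1}oz mulnC dvdn_pmul2l ?prime_gt0 //.
    case/primeP: (q_pr) => _ dv_q /dv_q/predU1P[k1 | /eqP kq].
      by rewrite oz k1 mul1n eqxx.
    have := not_cycle z.
    by rewrite eqEcard subsetT oG -orderE oz kq mulnC leqnn.
  rewrite Gauss_dvdr; last by rewrite coprime_sym prime_coprime.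
  case/primeP: (q_pr) => _ dv_q /dv_q; rewrite (negPf ntz) /= => ->.
  by rewrite orbT.
have not_sylow (r : nat) :
    prime r -> logn r #|[set: gT]| = 1%N -> #[x] = r -> #[y] <> r.
  move=> r_pr logr ox oy.
  have sylow (z : gT) : #[z] = r -> r.-Sylow([set: gT]) <[z]>.
    by move=> oz; rewrite pHallE subsetT p_part logr expn1 -orderE oz eqxx.
  have [g _ Dy] := Sylow_trans (sylow x ox) (sylow y oy).
  have /inv_gen_pairP/(_ g 1) gen := gxy.
  move/eqP: (not_cycle y); apply; apply/eqP.
  rewrite eqEsubset subsetT -gen conjg1 gen_subG subUset !sub1set.
  by rewrite cycle_id andbT Dy memJ_conjg cycle_id.
have nx_p := not_sylow p p_pr; have nx_q := not_sylow q q_pr.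
rewrite oG !lognM ?prime_gt0 // !logn_prime // !eqxx in nx_p nx_q.
rewrite (negPf npq) eq_sym (negPf npq) in nx_p nx_q.
have gyx := gxy; rewrite inv_gen_pairC in gyx.
have [ox|nox] := eqVneq #[x] p.
  by have /eqP/negPf-> := nx_p erefl ox.
have /eqP ox : #[x] == q by have := ord_pq _ _ gxy; rewrite (negPf nox).
have /eqP/negPf nyq := nx_q erefl ox.
by have := ord_pq _ _ gyx; rewrite nyq orbF => ->.
Qed.

(** Both [q] and, by Fermat, [p.-1] are exponents killing 2 modulo [p]. Were they coprime, Bezout
    would give 2 = 1 modulo [p]. *)
Lemma dvdn_pred_Mersenne (p q : nat) :
  prime p -> prime q -> p %| 2 ^ q - 1 -> q %| p.-1.
Proof.
move=> p_pr q_pr p_dv.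
have p_gt0 := prime_gt0 p_pr.
have p2q : 2 ^ q = 1 %[mod p] by apply/eqP; rewrite eqn_mod_dvd ?expn_gt0.
have co2p : coprime 2 p.
  rewrite coprime_sym prime_coprime //; apply: contraL p_dv => p_dv2.
  rewrite dvdn_subr ?expn_gt0 ?(dvdn_exp (prime_gt0 q_pr)) //.
  by rewrite dvdn1 neq_ltn prime_gt1 ?orbT.
have := Euler_exp_totient co2p; rewrite totient_prime // => p2p.
apply: contraT; rewrite -prime_coprime // => co_q.
have [a b Dab _] := egcdnP p.-1 (prime_gt0 q_pr).
have : 2 ^ (a * q) = 2 ^ (b * p.-1 + 1) %[mod p].
  by rewrite Dab (eqP co_q).
rewrite expnD (mulnC a) (mulnC b) !expnM -modnXm p2q modnXm exp1n.
rewrite -modnMml -modnXm p2p modnXm exp1n modnMml mul1n => /eqP.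
by rewrite eq_sym eqn_mod_dvd // dvdn1 => /eqP p1; rewrite p1 in p_pr.
Qed.

(** Cauchy's theorem gives an automorphism [a] of order [q] of the cyclic group of order [p]; the
    group is the resulting semidirect product. If it were abelian, [a] would act trivially. *)
Lemma noncyclic_sdprod (p q : nat) : prime p -> prime q -> q %| p.-1 ->
  exists gT : finGroupType, #|[set: gT]| = (p * q)%N /\ ~~ cyclic [set: gT].
Proof.
move=> p_pr q_pr q_dv; have p_gt1 := prime_gt1 p_pr.
pose P := Zp p; have oP : #|P| = p by rewrite card_Zp ?prime_gt0.
have cycP : cyclic P by rewrite prime_cyclic ?oP.
have [|a Aa oa] := @Cauchy _ q (Aut P) q_pr.
  by rewrite card_Aut_cyclic // oP totient_prime.
have sAD : <[a]> \subset Aut P by rewrite cycle_subG.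
pose to := ([Aut P] \ sAD)%gact; exists (sdprod_by to); split.
  rewrite -(sdprod_card (sdprod_sdpair to)).
  by rewrite !card_injm ?injm_sdpair1 ?injm_sdpair2 // oP -oa.
apply: contraL (prime_gt1 q_pr) => /cyclic_abelian abG.
rewrite -oa -leqNgt; suff -> : a = 1 by rewrite order1.
apply: (eq_Aut Aa (group1 _)) => x Px; rewrite perm1.
apply: (injmP (injm_sdpair1 to)) => //; first by rewrite Aut_closed.
have := sdpair_act to Px (cycle_id a).
rewrite conjgE (centsP abG _ (in_setT _) _ (in_setT _)) mulgK.
by rewrite /= /ract /autact.
Qed.

(** Choosing [q] above [m] and then [p] among the prime factors of [2 ^ q - 1] yields [q %| p.-1]
    without Dirichlet's theorem on primes in progressions. It also forces [m < q < p], hence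
    coprimality to [m]. *)
Lemma noncyclic_primes (m : nat) : 0 < m ->
  exists (p q : nat) (gT : finGroupType),
    [/\ prime p, prime q, p != q, #|[set: gT]| = (p * q)%N &
      ~~ cyclic [set: gT] /\ coprime (p * q) m].
Proof.
move=> m_gt0; have [q lt_mq q_pr] := prime_above m.
have M_gt1 : 1 < 2 ^ q - 1.
  by rewrite ltn_subRL (leq_trans _ (leq_pexp2l _ (prime_gt1 q_pr))).
pose p := pdiv (2 ^ q - 1); have p_pr : prime p := pdiv_prime M_gt1.
have q_dv : q %| p.-1 := dvdn_pred_Mersenne p_pr q_pr (pdiv_dvd _).
have lt_qp : q < p.
  rewrite -(prednK (prime_gt0 p_pr)) ltnS dvdn_leq //.
  by rewrite -subn1 subn_gt0 prime_gt1.
have [gT [oG ncG]] := noncyclic_sdprod p_pr q_pr q_dv.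
have co_m r : prime r -> m < r -> coprime r m.
  by move=> r_pr lt_mr; rewrite prime_coprime // gtnNdvd.
exists p, q, gT; split=> //; first by rewrite gtn_eqF.
by rewrite coprimeMl !co_m // (ltn_trans lt_mq).
Qed.

(* [c] is the side in one chosen factor, and [f] records the sides in the other
   factors relative to it. *)
Definition separates (gT : finGroupType) (c : gT -> bool) (T : finType)
    (f : gT -> T) : Prop :=
  (forall x y, inv_gen_pair x y -> c x != c y /\ f x = f y)
  /\ (forall t, exists x y, inv_gen_pair x y /\ f x = t).

Lemma separates_primes (gT : finGroupType) (p q : nat) :
    prime p -> prime q -> p != q -> #|[set: gT]| = (p * q)%N ->
    ~~ cyclic [set: gT] ->
  separates (fun x : gT => #[x] == p) (fun=> tt).
Proof.
move=> p_pr q_pr npq oG ncG; split=> [x y gxy | []].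
  by rewrite (inv_gen_pair_primes p_pr q_pr).
have [|x _ ox] := @Cauchy _ p [set: gT] p_pr; first by rewrite oG dvdn_mulr.
have [|y _ oy] := @Cauchy _ q [set: gT] q_pr; first by rewrite oG dvdn_mull.
(* Conjugation preserves orders, so any such subgroup has order divisible by both [p] and [q]. *)
exists x, y; split=> //; apply/inv_gen_pairP=> g h.
apply/eqP; rewrite eqEcard subsetT oG dvdn_leq ?cardG_gt0 //.
rewrite Gauss_dvd; last by rewrite prime_coprime ?dvdn_prime2.
rewrite -{1}ox -{1}oy -(orderJ x g) -(orderJ y h).
by rewrite !order_dvdG ?mem_gen ?inE ?eqxx ?orbT.
Qed.

Lemma separates_prod (gT1 gT2 : finGroupType) (c1 : gT1 -> bool)
    (c2 : gT2 -> bool) (T1 T2 : finType) (f1 : gT1 -> T1) (f2 : gT2 -> T2) :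
    coprime #|[set: gT1]| #|[set: gT2]| ->
    separates c1 f1 -> separates c2 f2 ->
  separates (fun u : gT1 * gT2 => c1 u.1)
            (fun u => (c1 u.1 (+) c2 u.2, (f1 u.1, f2 u.2))).
Proof.
move=> co12 [sep1 real1] [sep2 real2]; split=> [u v | [b [t1 t2]]].
  rewrite inv_gen_pair_prod // => /andP[/sep1[nc1 ->] /sep2[nc2 ->]].
  split=> //; congr (_, _).
  by case: (c1 u.1) (c1 v.1) (c2 u.2) (c2 v.2) nc1 nc2 => [] [] [] [].
have [x [y [gxy fx]]] := real1 t1; have [x' [y' [gxy' fx']]] := real2 t2.
have [/addbP nc1 f1xy] := sep1 _ _ gxy; have [/addbP nc2 f2xy] := sep2 _ _ gxy'.
have [Db | nDb] := eqVneq (c1 x (+) c2 x') b.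
  exists (x, x'), (y, y').
  by rewrite inv_gen_pair_prod // gxy gxy' /= fx fx' Db.
(* Swapping the pair of the second factor flips [c2] in the first entry, hence the parity, and
   leaves [f2] unchanged. *)
exists (x, y'), (y, x').
rewrite inv_gen_pair_prod // gxy inv_gen_pairC gxy' /= fx -f2xy fx'.
split=> //; congr (_, _).
by case: (c1 x) (c2 x') (c2 y') b nDb nc2 => [] [] [] [].
Qed.

(** The arbitrary [m] only serves the induction: each new factor is chosen coprime to [m] and to the
    order of the group built so far. *)
Lemma separates_large (n m : nat) : 0 < m ->
  exists (gT : finGroupType) (c : gT -> bool) (T : finType) (f : gT -> T),
    [/\ coprime #|[set: gT]| m, separates c f & n < #|T|].
Proof.
elim: n m => [|n IHn] m m_gt0.
  have [p [q [gT [p_pr q_pr npq oG [ncG com]]]]] := noncyclic_primes m_gt0.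
  exists gT, (fun x => #[x] == p), unit, (fun=> tt).
  by rewrite oG card_unit; split=> //; apply: separates_primes q_pr _ _ _.
have [gT [c [T [f [com sep ltnT]]]]] := IHn m m_gt0.
have [|p [q [gT' [p_pr q_pr npq oG [ncG com']]]]] :=
  @noncyclic_primes (#|[set: gT]| * m); first by rewrite muln_gt0 cardG_gt0.
have sep' := separates_primes p_pr q_pr npq oG ncG.
move: com'; rewrite coprimeMr -oG => /andP[co12 com'].
(* Unification with [separates_prod] supplies the four witnesses, so that goal comes first. Its
   boolean coordinate doubles the number of values. *)
do 4!eexists; split; last 2 first.
- exact: separates_prod co12 sep' sep.
- rewrite !card_prod card_bool card_unit mul1n.
  by rewrite mul2n -addnn -addn1 leq_add // (leq_trans _ ltnT).
by rewrite cardsT card_prod -!cardsT coprimeMl com' com.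
Qed.

(** * From separating functions to connected components *)

Lemma separates_components (gT : finGroupType) (c : gT -> bool) (T : finType)
    (f : gT -> T) :
  separates c f -> #|T| <= Lambda_plus_components [set: gT].
Proof.
move=> [sep real].
pose e := Lambda_adj [set: gT]; pose F (C : {set gT}) := f (repr C).
have sym_e : connect_sym e by apply/sym_connect_sym/Lambda_adj_sym.
(* If [x] were 1, then [y] would form an invariably generating pair with itself, contradicting
   [c y != c y]. *)
have nt (x y : gT) : inv_gen_pair x y -> x != 1.
  move=> /inv_gen_pairP gen; apply/eqP=> x1.
  suff gyy : inv_gen_pair y y by have [/eqP] := sep _ _ gyy.
  apply/inv_gen_pairP=> g h; apply/eqP.
  rewrite eqEsubset subsetT -{1}(gen 1 g) x1 conj1g /=.
  by rewrite gen_subG subUset !sub1set group1 mem_gen ?inE ?eqxx.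
have F_e C D : e C D -> F C = F D.
  case/and4P=> /setD1P[_ /imsetP[x _ DC]] /setD1P[_ /imsetP[y _ DD]] _ gen.
  have reprK (z : gT) E : E = z ^: [set: gT] -> repr E ^: [set: gT] = E.
    by move->; apply/class_eqP/(mem_repr z)/class_refl.
  suff gCD : inv_gen_pair (repr C) (repr D) by have [] := sep _ _ gCD.
  by rewrite /inv_gen_pair (reprK x) ?(reprK y).
have F_conn C D : connect e C D -> F C = F D.
  case/connectP=> s + ->.
  by elim: s C => //= A s IHs C /andP[/F_e -> /IHs].
have edge (x y : gT) : inv_gen_pair x y -> e (x ^: [set: gT]) (y ^: [set: gT]).
  move=> gxy; have gyx := gxy; rewrite inv_gen_pairC in gyx.
  have class_vertex (z : gT) :
      z != 1 -> z ^: [set: gT] \in Lambda_vertices [set: gT].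
    by move=> ntz; rewrite !inE classG_eq1 ntz mem_classes ?inE.
  rewrite /e /Lambda_adj !class_vertex ?(nt _ _ gxy) ?(nt _ _ gyx) //=.
  apply/andP; split=> //; apply/eqP=> eq_xy.
  have gxx : inv_gen_pair x x by rewrite /inv_gen_pair {2}eq_xy.
  by have [/eqP] := sep _ _ gxx.
(* [f] is not assumed to be a class function, but [x] and the representative of its class share the
   partner [y], so [f] agrees on all three. *)
have F_class (x y : gT) : inv_gen_pair x y -> F (x ^: [set: gT]) = f x.
  move=> gxy; have xC := mem_repr x (class_refl [set: gT] x).
  have [_ ->] := sep _ _ gxy.
  have grxy : inv_gen_pair (repr (x ^: [set: gT])) y.
    by rewrite /inv_gen_pair (class_eqP xC).
  by have [] := sep _ _ grxy.
apply: leq_trans (leq_image_card F _).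
apply/subset_leq_card/subsetP=> t _; have [x [y [gxy <-]]] := real t.
(* [n_comp] counts roots, so each value of [f] has to be attained by [F] at the root of a
   component. *)
apply/imageP; exists (fingraph.root e (x ^: [set: gT])).
  rewrite inE /= roots_root //=.
  have := edge x y gxy; have := connect_root e (x ^: [set: gT]).
  move/(closed_connect (@Lambda_plus_closed _ [set: gT])) => <- exy.
  rewrite inE; apply/andP; split; first by case/andP: exy.
  by apply/existsP; exists (y ^: [set: gT]).
by rewrite -(F_class x y) //; apply/F_conn/connect_root.
Qed.

Theorem theorem1p1 (n : nat) (n_gt0 : 0 < n) :
  exists (gT : finGroupType) (G : {group gT}), n < Lambda_plus_components G.
Proof.
have [gT [c [T [f [_ sep lt_nT]]]]] := separates_large n (ltnSn 0).
exists gT, [set: gT]%G; exact: leq_trans lt_nT (separates_components sep).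
Qed.
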